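(* If a dagger category has dagger equalizers (of all parallel pairs of morphisms) and dagger products of all small families of objects, infinite families included, then it is indiscrete.
   Context: A dagger category is a category equipped with an identity-on-objects functor $\dagger\colon\mathbf{C}^{\mathrm{op}}\to\mathbf{C}$ satisfying $f^{\dagger\dagger}=f$. A morphism $f\colon A\to B$ is dagger monic if $f^\dagger f=\mathrm{id}_A$, and a partial isometry if $f=ff^\dagger f$. A category is indiscrete if there is exactly one morphism between any two objects. A dagger equalizer of $f,g\colon A\to B$ is an equalizer $e\colon E\to A$ of $f$ and $g$ that is dagger monic. A dagger product of a family $(A_i)_{i\in I}$ of objects is a product $P$ with projections $p_i\colon P\to A_i$ such that every $p_i$ is a partial isometry and $p_i^\dagger p_i p_j^\dagger p_j=p_j^\dagger p_j p_i^\dagger p_i$ for all $i,j\in I$. (The empty dagger product is a terminal object.) *)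

(* Defs.v *)
Set Implicit Arguments.
Unset Strict Implicit.
Unset Printing Implicit Defensive.

Declare Scope dagger_scope.
Open Scope dagger_scope.

Reserved Notation "g ∘ f" (at level 40, left associativity).
Reserved Notation "f †" (at level 1, left associativity, format "f †").

Record category := Category {
  obj :> Type;
  hom : obj -> obj -> Type;
  id : forall A, hom A A;
  comp : forall A B C, hom B C -> hom A B -> hom A C;
  comp_id_l : forall A B (f : hom A B), comp (id B) f = f;
  comp_id_r : forall A B (f : hom A B), comp f (id A) = f;
  comp_assoc : forall A B C D (h : hom C D) (g : hom B C) (f : hom A B),
    comp h (comp g f) = comp (comp h g) f
}.

Arguments hom {c} A B.
Arguments id {c} A.
Arguments comp {c A B C} g f.

Notation "g ∘ f" := (comp g f) : dagger_scope.

Record dagger_category := DaggerCategory {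
  cat :> category;
  dagger : forall A B : cat, hom A B -> hom B A;
  dagger_id : forall A : cat, dagger (id A) = id A;
  dagger_comp : forall (A B C : cat) (g : hom B C) (f : hom A B),
    dagger (g ∘ f) = dagger f ∘ dagger g;
  dagger_dagger : forall (A B : cat) (f : hom A B), dagger (dagger f) = f
}.

Arguments dagger {d A B} f.

Notation "f †" := (dagger f) : dagger_scope.

Definition dagger_monic (C : dagger_category) (A B : C) (f : hom A B) : Prop :=
  f† ∘ f = id A.

Definition partial_isometry (C : dagger_category) (A B : C) (f : hom A B) :
    Prop :=
  f = f ∘ f† ∘ f.

Definition indiscrete (C : category) : Prop :=
  forall A B : C, exists! _ : hom A B, True.

Definition is_equalizer (C : category) (A B : C) (f g : hom A B)
    (E : C) (e : hom E A) : Prop :=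
  f ∘ e = g ∘ e /\
  forall (X : C) (x : hom X A), f ∘ x = g ∘ x ->
    exists! u : hom X E, e ∘ u = x.

Definition is_product (C : category) (I : Type) (A : I -> C)
    (P : C) (p : forall i, hom P (A i)) : Prop :=
  forall (X : C) (x : forall i, hom X (A i)),
    exists! u : hom X P, forall i, p i ∘ u = x i.

Definition is_dagger_equalizer (C : dagger_category) (A B : C) (f g : hom A B)
    (E : C) (e : hom E A) : Prop :=
  is_equalizer f g e /\ dagger_monic e.

Definition is_dagger_product (C : dagger_category) (I : Type) (A : I -> C)
    (P : C) (p : forall i, hom P (A i)) : Prop :=
  is_product p /\
  (forall i, partial_isometry (p i)) /\
  (forall i j, ((p i)† ∘ p i) ∘ ((p j)† ∘ p j) =
               ((p j)† ∘ p j) ∘ ((p i)† ∘ p i)).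

Definition has_dagger_equalizers (C : dagger_category) : Prop :=
  forall (A B : C) (f g : hom A B),
    exists (E : C) (e : hom E A), is_dagger_equalizer f g e.

(* "Small" means indexed by a type in one fixed universe, which is not related
   to the universes of the objects and morphisms of [C]: neither a small nor a
   locally small [C] is required. *)
Definition has_small_dagger_products (C : dagger_category) : Prop :=
  forall (I : Type) (A : I -> C),
    exists (P : C) (p : forall i, hom P (A i)), is_dagger_product p.

(* Main.v *)
From Stdlib Require Import PeanoNat.
Require Import Defs.

Set Implicit Arguments.
Unset Strict Implicit.
Unset Printing Implicit Defensive.

(** The empty product is a zero object, so there are zero morphisms, and the
    projections of a dagger product, together with their daggers, then satisfy
    the equations of a biproduct ([projection_coisometry],
    [projections_orthogonal]). Hence arbitrary families of parallel morphisms
    can be added. Dagger equalizers make addition cancellative: if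
    [f + h = g + h], then the projection [e ∘ e†] onto the equalizer of
    [[f, h]] and [[g, h]] fixes the diagonal and the second injection, and a
    self-adjoint morphism that does so is the identity, whence [f = g]. In the
    presence of infinite sums this is fatal: [id + S = S] for the sum [S] of
    countably many copies of [id], so [id = 0].

    The proof merges cancellation and swindle in the single countable power
    [P] of an object [A]. Let [d = (1, 1, 1, ...)] and [w = (0, 1, 1, ...)] be
    morphisms [A -> P]. The row vectors [d†] and [w†] agree on every injection
    except the one with index [0]; they also agree on the column [d], because
    [w] is the shift of [d] ([swindle]). By the cancellation argument
    ([fixes_remaining_injection]) they agree on the remaining injection as
    well, where their values are [id] and [0]. *)

Definition is_terminal (C : category) (T : C) : Prop :=
  forall X : C, exists! _ : hom X T, True.

(** Zero morphisms are a predicate and not a chosen family: the unique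
    morphisms into [T] are only known to exist, and to collect them into a
    function would take a choice principle. *)
Definition is_zero (C : category) (T A B : C) (f : hom A B) : Prop :=
  exists (b : hom T B) (a : hom A T), f = b ∘ a.

Lemma is_zero_precomp (C : category) (T A B D : C) (f : hom B D)
    (g : hom A B) : is_zero T f -> is_zero T (f ∘ g).
Proof.
  intros [b [a ->]]. exists b, (a ∘ g). now rewrite comp_assoc.
Qed.

Lemma is_zero_postcomp (C : category) (T A B D : C) (f : hom B D)
    (g : hom A B) : is_zero T g -> is_zero T (f ∘ g).
Proof.
  intros [b [a ->]]. exists (f ∘ b), a. now rewrite comp_assoc.
Qed.

Lemma is_zero_dagger (C : dagger_category) (T A B : C) (f : hom A B) :
  is_zero T f -> is_zero T (f†).
Proof.
  intros [b [a ->]]. exists (a†), (b†). now rewrite dagger_comp.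
Qed.

(** The dagger turns the terminal object into an initial one as well. *)
Lemma is_zero_unique (C : dagger_category) (T A B : C) (f g : hom A B) :
  is_terminal T -> is_zero T f -> is_zero T g -> f = g.
Proof.
  intros hT [b [a ->]] [b' [a' ->]].
  assert (hom_T_unique : forall (X : C) (u v : hom X T), u = v).
  { intros X u v. destruct (hT X) as [t [_ ht]].
    now rewrite <- (ht u Logic.I), (ht v Logic.I). }
  rewrite (hom_T_unique A a a').
  now rewrite <- (dagger_dagger b), <- (dagger_dagger b'),
    (hom_T_unique B (b†) (b'†)).
Qed.

Lemma is_zero_exists (C : dagger_category) (T : C) :
  is_terminal T -> forall A B : C, exists z : hom A B, is_zero T z.
Proof.
  intros hT A B.
  destruct (hT A) as [a _], (hT B) as [b _].
  exists (b† ∘ a), (b†), a. reflexivity.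
Qed.

Lemma empty_product_terminal (C : category) (A : Empty_set -> C) (P : C)
    (p : forall i, hom P (A i)) : is_product p -> is_terminal P.
Proof.
  intros hp X.
  destruct (hp X (fun i => match i with end)) as [u [_ hu]].
  exists u. split; [exact Logic.I|].
  intros v _. apply hu. intros [].
Qed.

Lemma product_hom_ext (C : category) (I : Type) (A : I -> C) (P : C)
    (p : forall i, hom P (A i)) (X : C) (u v : hom X P) :
  is_product p -> (forall i, p i ∘ u = p i ∘ v) -> u = v.
Proof.
  intros hp huv.
  destruct (hp X (fun i => p i ∘ v)) as [w [_ hw]].
  now rewrite <- (hw u huv), (hw v (fun i => eq_refl)).
Qed.

Lemma split_partial_isometry (C : dagger_category) (P A : C) (p : hom P A)
    (u : hom A P) : partial_isometry p -> p ∘ u = id A -> p ∘ p† = id A.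
Proof.
  unfold partial_isometry. intros hp hu.
  rewrite <- (comp_id_r (p ∘ p†)), <- hu, comp_assoc.
  now rewrite <- hp.
Qed.

(** Evaluating the two products of projections at [u] gives [q† ∘ q ∘ p†] on
    one side and zero on the other. *)
Lemma commuting_projections_orthogonal (C : dagger_category) (T P A B : C)
    (p : hom P A) (q : hom P B) (u : hom A P) :
  partial_isometry q ->
  (q† ∘ q) ∘ (p† ∘ p) = (p† ∘ p) ∘ (q† ∘ q) ->
  p ∘ u = id A -> is_zero T (q ∘ u) -> is_zero T (q ∘ p†).
Proof.
  unfold partial_isometry. intros hq hcomm hpu hqu.
  assert (heval : (q† ∘ q) ∘ p† = (p† ∘ p) ∘ q† ∘ (q ∘ u)).
  { apply (f_equal (fun f => f ∘ u)) in hcomm.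
    rewrite <- !comp_assoc, hpu, comp_id_r in hcomm.
    rewrite <- !comp_assoc. exact hcomm. }
  rewrite hq, <- !comp_assoc, (comp_assoc (q†) q (p†)), heval.
  now apply is_zero_postcomp, is_zero_postcomp.
Qed.

Section Power.

Context (C : dagger_category) (T : C) (hT : is_terminal T).
Context (I : Type) (eq_dec : forall i j : I, {i = j} + {i <> j}).
Context (A P : C) (p : I -> hom P A).
Context (hp : is_dagger_product (A := fun _ => A) p).

Lemma power_unit_vector (i : I) :
  exists u : hom A P,
    p i ∘ u = id A /\ forall j, j <> i -> is_zero T (p j ∘ u).
Proof.
  destruct (is_zero_exists hT A A) as [z hz].
  destruct hp as [hprod _].
  destruct (hprod A (fun j => if eq_dec j i then id A else z)) as [u [hu _]].
  exists u. split.
  - rewrite hu. now destruct (eq_dec i i).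
  - intros j hj. rewrite hu. now destruct (eq_dec j i).
Qed.

Lemma projection_coisometry (i : I) : p i ∘ (p i)† = id A.
Proof.
  destruct (power_unit_vector i) as [u [hu _]].
  apply split_partial_isometry with u; [apply hp | exact hu].
Qed.

Lemma projections_orthogonal (i j : I) :
  j <> i -> is_zero T (p j ∘ (p i)†).
Proof.
  intros hij. destruct (power_unit_vector i) as [u [hui huj]].
  destruct hp as [_ [hpi hcomm]].
  apply commuting_projections_orthogonal with u; auto.
Qed.

(** Cancellation. Orthogonality to the fixed injections forces [q] to map the
    injection [(p i)†] to a multiple [(p i)† ∘ a] of itself; by
    self-adjointness [p i ∘ q = a† ∘ p i], and evaluation at [d] gives
    [a† = id]. *)
Lemma fixes_remaining_injection (i : I) (q : hom P P) (d : hom A P) :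
  q† = q -> p i ∘ d = id A -> q ∘ d = d ->
  (forall j, j <> i -> q ∘ (p j)† = (p j)†) ->
  q ∘ (p i)† = (p i)†.
Proof.
  intros hself hd hqd hfix.
  set (a := p i ∘ q ∘ (p i)†).
  assert (hcol : q ∘ (p i)† = (p i)† ∘ a).
  { apply (product_hom_ext (proj1 hp)). intros j.
    destruct (eq_dec j i) as [-> | hj].
    - now rewrite (comp_assoc (p i) ((p i)†) a), projection_coisometry,
        comp_id_l, comp_assoc.
    - (* The row [p j ∘ q] is the dagger of the fixed column [q ∘ (p j)†]. *)
      assert (hrow : p j ∘ q = p j).
      { generalize (f_equal dagger (hfix j hj)).
        now rewrite dagger_comp, dagger_dagger, hself. }
      apply (is_zero_unique hT).
      + rewrite comp_assoc, hrow. now apply projections_orthogonal.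
      + rewrite comp_assoc. now apply is_zero_precomp, projections_orthogonal. }
  assert (hrow : p i ∘ q = a† ∘ p i).
  { apply (f_equal dagger) in hcol.
    now rewrite !dagger_comp, dagger_dagger, hself in hcol. }
  assert (ha : a† = id A).
  { now rewrite <- (comp_id_r (a†)), <- hd, comp_assoc, <- hrow,
      <- comp_assoc, hqd. }
  apply (f_equal dagger) in ha. rewrite dagger_dagger, dagger_id in ha.
  now rewrite hcol, ha, comp_id_r.
Qed.

End Power.

(** The Eilenberg swindle [1 + 1 + ... = 0 + 1 + 1 + ...], read as the equality
    of the inner products [d† ∘ d] and [w† ∘ d]. The shift [s] on the
    power sends each injection to the next one, so [s†] forgets the first
    coordinate; therefore [s ∘ d = w] while [s† ∘ d = d]. *)
Lemma swindle (C : dagger_category) (T A P : C) (p : nat -> hom P A)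
    (d w : hom A P) :
  is_terminal T -> is_dagger_product (A := fun _ => A) p ->
  (forall n, p n ∘ d = id A) ->
  is_zero T (p 0 ∘ w) -> (forall n, p (S n) ∘ w = id A) ->
  d† ∘ d = w† ∘ d.
Proof.
  intros hT hp hd hw0 hw.
  destruct (is_zero_exists hT P A) as [z hz].
  destruct (proj1 hp P (fun n => match n with 0 => z | S m => p m end))
    as [s [hs _]].
  assert (hs0 : p 0 ∘ s = z) by exact (hs 0).
  assert (hsS : forall n, p (S n) ∘ s = p n) by exact (fun n => hs (S n)).
  assert (hshift : forall n, s ∘ (p n)† = (p (S n))†).
  { intros n. apply (product_hom_ext (proj1 hp)). intros [|m].
    - apply (is_zero_unique hT).
      + rewrite comp_assoc, hs0. now apply is_zero_precomp.
      + now apply (projections_orthogonal hT Nat.eq_dec hp).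
    - rewrite comp_assoc, hsS.
      destruct (Nat.eq_dec m n) as [-> | hmn].
      + now rewrite !(projection_coisometry hT Nat.eq_dec hp).
      + apply (is_zero_unique hT);
          apply (projections_orthogonal hT Nat.eq_dec hp); congruence. }
  assert (hsd : s ∘ d = w).
  { apply (product_hom_ext (proj1 hp)). intros [|n]; rewrite comp_assoc.
    - apply (is_zero_unique hT); [|exact hw0].
      rewrite hs0. now apply is_zero_precomp.
    - now rewrite hsS, hd, hw. }
  assert (hsd' : s† ∘ d = d).
  { apply (product_hom_ext (proj1 hp)). intros n.
    assert (hrow : p n ∘ s† = p (S n)).
    { generalize (f_equal dagger (hshift n)).
      now rewrite dagger_comp, !dagger_dagger. }
    now rewrite comp_assoc, hrow, !hd. }
  now rewrite <- hsd, dagger_comp, <- comp_assoc, hsd'.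
Qed.

Lemma equalizer_projection_fixes (C : dagger_category) (A B E X : C)
    (f g : hom A B) (e : hom E A) (x : hom X A) :
  is_dagger_equalizer f g e -> f ∘ x = g ∘ x -> (e ∘ e†) ∘ x = x.
Proof.
  intros [[_ huniv] hmonic] hx. unfold dagger_monic in hmonic.
  destruct (huniv X x hx) as [k [<- _]].
  now rewrite <- comp_assoc, (comp_assoc (e†) e k), hmonic, comp_id_l.
Qed.

(** The row vectors [d†] and [w†] are equalized by [e]. Its projection fixes
    [d] and all injections but the first, hence also the first, on which the
    row vectors take the values [id A] and zero. *)
Lemma identity_is_zero (C : dagger_category) (T A : C) :
  has_dagger_equalizers C -> has_small_dagger_products C -> is_terminal T ->
  is_zero T (id A).
Proof.
  intros heq hprod hT.
  destruct (hprod nat (fun _ => A)) as [P [p hp]].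
  destruct (is_zero_exists hT A A) as [z hz].
  destruct (proj1 hp A (fun _ => id A)) as [d [hd _]].
  destruct (proj1 hp A (fun n => match n with 0 => z | S _ => id A end))
    as [w [hw _]].
  assert (hw0 : p 0 ∘ w = z) by exact (hw 0).
  assert (hwS : forall n, p (S n) ∘ w = id A) by exact (fun n => hw (S n)).
  assert (hzero : is_zero T (p 0 ∘ w)) by now rewrite hw0.
  destruct (heq P A (d†) (w†)) as [E [e he]].
  assert (hfix0 : (e ∘ e†) ∘ (p 0)† = (p 0)†).
  { apply (fixes_remaining_injection hT Nat.eq_dec hp)
      with (d := d).
    - now rewrite dagger_comp, dagger_dagger.
    - apply hd.
    - apply (equalizer_projection_fixes he).
      exact (swindle hT hp hd hzero hwS).
    - intros [|n] hn; [congruence|].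
      apply (equalizer_projection_fixes he).
      now rewrite <- !dagger_comp, hd, hwS. }
  assert (hrows : d† ∘ (p 0)† = w† ∘ (p 0)†).
  { rewrite <- hfix0, !comp_assoc. now rewrite (proj1 (proj1 he)). }
  rewrite <- !dagger_comp, hd, dagger_id in hrows.
  rewrite hrows. now apply is_zero_dagger.
Qed.

Theorem theorem5p2 (C : dagger_category)
  (heq : has_dagger_equalizers C)
  (hprod : has_small_dagger_products C) :
  indiscrete C.
Proof.
  destruct (hprod Empty_set (fun i => match i with end)) as [T [t ht]].
  assert (hT : is_terminal T) by exact (empty_product_terminal (proj1 ht)).
  intros A B.
  destruct (is_zero_exists hT A B) as [z hz].
  exists z. split; [exact Logic.I|].
  intros f _. apply (is_zero_unique hT hz).
  rewrite <- (comp_id_r f).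
  now apply is_zero_postcomp, identity_is_zero.
Qed.
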